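(* Let $T$ be a bounded, linear, bijective operator on $L^2(G,\mathbb{C}^{s\times r})$ that is adjointable with respect to the matrix-valued inner product. Then $T$ is positive if and only if $T$ maps some matrix-valued Riesz basis of $L^2(G,\mathbb{C}^{s\times r})$ to its matrix-valued dual Riesz basis; that is, if and only if there exist a matrix-valued orthonormal basis $\{E_k\}_{k\in\mathbb{N}}$ and a bounded, linear, bijective operator $U$ adjointable with respect to the matrix-valued inner product such that $T(UE_k)=(U^{-1})^*E_k$ for all $k\in\mathbb{N}$.
   Context: $G$ is a locally compact abelian group that is metrizable and $\sigma$-compact, with Haar measure $\mu_G$; $s,r\in\mathbb{N}$. $L^2(G,\mathbb{C}^{s\times r})$ is the space of $s\times r$ matrices with all entries in $L^2(G)$. The matrix-valued inner product is $\langle \mathbf{f},\mathbf{g}\rangle=\int_G \mathbf{f}(x)\mathbf{g}^*(x)\,d\mu_G\in M_s(\mathbb{C})$ (entrywise integral). $L^2(G,\mathbb{C}^{s\times r})$ is a Hilbert space with inner product $\langle \mathbf{f},\mathbf{g}\rangle_{L^2}=\mathrm{tr}\langle \mathbf{f},\mathbf{g}\rangle$ and Frobenius norm; $U^*$ denotes the Hilbert-adjoint with respect to this inner product. $U$ is adjointable with respect to the matrix-valued inner product if $\langle U\mathbf{f},\mathbf{g}\rangle=\langle\mathbf{f},U^*\mathbf{g}\rangle$ for all $\mathbf{f},\mathbf{g}$. $T$ is positive if $T^*=T$ and $\mathrm{tr}\langle T\mathbf{f},\mathbf{f}\rangle\ge0$ for all $\mathbf{f}$. A matrix-valued orthonormal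 basis is a sequence $\{E_k\}_{k\in\mathbb{N}}$ with $\langle E_k,E_j\rangle=\mathbf{I}_{s\times s}$ if $k=j$ and $\mathbf{O}_{s\times s}$ otherwise, such that $\mathbf{f}=\sum_k\langle\mathbf{f},E_k\rangle E_k$ in Frobenius norm for all $\mathbf{f}$. A matrix-valued Riesz basis is a family $\{\mathbf{f}_k\}=\{UE_k\}_{k\in\mathbb{N}}$ with $\{E_k\}$ a matrix-valued orthonormal basis and $U$ bounded, linear, bijective and adjointable with respect to the matrix-valued inner product; its (matrix-valued) dual Riesz basis is $\{\mathbf{g}_k\}=\{(U^{-1})^*E_k\}_{k\in\mathbb{N}}$, which satisfies $\mathbf{f}=\sum_k\langle\mathbf{f},\mathbf{g}_k\rangle\mathbf{f}_k$ for all $\mathbf{f}$.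
   Formalization: It is additionally assumed that the space of matrix-valued functions has a matrix-valued orthonormal basis indexed by ℕ; this fails e.g. for finite G, where the identity is positive but no such basis exists, so the stated equivalence is false there. *)

(* Defs.v *)
(* MathComp + MathComp-Analysis (+ real_closed's complex numbers R[i]). *)
From HB Require Import structures.
From mathcomp Require Import all_boot all_order all_algebra.
From mathcomp Require Import all_classical all_reals all_analysis.
From mathcomp Require Import complex.
Set Implicit Arguments.
Unset Strict Implicit.
Unset Printing Implicit Defensive.
Import Order.TTheory GRing.Theory Num.Theory.
Import numFieldNormedType.Exports.
Local Open Scope classical_set_scope.
Local Open Scope ring_scope.
Local Open Scope complex_scope.

(* The group G: a topological abelian group (topologicalZmodType: abelian    *)
(* group, continuous addition and opposite) which is Hausdorff, locally      *)
(* compact, metrizable and sigma-compact.                                     *)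

(* carrier of G, pointed at 0, so that we can equip it with its Borel sets *)
Definition ptd (G : topologicalZmodType) : Type := G.
HB.instance Definition _ (G : topologicalZmodType) := Choice.on (ptd G).
HB.instance Definition _ (G : topologicalZmodType) :=
  isPointed.Build (ptd G) (0 : G).

(* G with its Borel sigma-algebra (generated by the open sets of G) *)
Definition borel (G : topologicalZmodType) : Type :=
  g_sigma_algebraType (@open G : set (set (ptd G))).

Definition LCA_group (G : topologicalZmodType) : Prop :=
  hausdorff_space G /\ locally_compact [set: G].

(* the topology of G is induced by a metric *)
Definition metrizable (R : realType) (G : topologicalZmodType) : Prop :=
  exists d : G -> G -> R,
    [/\ (forall x y, d x y = 0 <-> x = y),
        (forall x y, d x y = d y x),
        (forall x y z, d x z <= d x y + d y z) &
        (forall (x : G) (A : set G),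
           nbhs x A <-> exists e : R, 0 < e /\ [set y | d x y < e] `<=` A)].

Definition sigma_compact (G : topologicalZmodType) : Prop :=
  exists K : nat -> set G,
    (forall n, compact (K n)) /\ \bigcup_n K n = [set: G].

(* Haar measure: nonzero translation-invariant Radon measure on the Borel sets *)
Definition haar_measure (R : realType) (G : topologicalZmodType)
    (mu : {measure set (borel G) -> \bar R}) : Prop :=
  [/\ (forall (a : G) (A : set (borel G)), measurable A ->
         mu [set (a + x : G) | x in A] = mu A),
      (forall K : set G, compact K -> (mu K < +oo)%E),
      (forall U : set G, open U -> U !=set0 -> (0 < mu U)%E),
      (forall A : set (borel G), measurable A ->
         mu A = ereal_inf [set mu U | U in [set U : set G | open U /\ A `<=` U]]) &
      (forall U : set G, open U ->
         mu U = ereal_sup [set mu K | K in [set K : set G | compact K /\ K `<=` U]])].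

(* L^2(G, C^{s x r})                                                         *)

Section L2.
Variables (R : realType) (G : topologicalZmodType)
  (mu : {measure set (borel G) -> \bar R}) (s r : nat).

Local Notation C := (R[i]).
Local Notation Mx := ('M[C]_(s, r)).

Definition cnormsq (z : C) : R := (complex.Re z) ^+ 2 + (complex.Im z) ^+ 2.

(* f : G -> C^{s x r} has all entries (measurable and) in L^2(G, mu) *)
Definition L2 (f : G -> Mx) : Prop :=
  forall i j,
    [/\ measurable_fun [set: borel G] (fun x : borel G => complex.Re (f x i j)),
        measurable_fun [set: borel G] (fun x : borel G => complex.Im (f x i j)) &
        (\int[mu]_(x in [set: borel G]) (cnormsq (f x i j))%:E < +oo)%E].

(* equality in L^2: almost-everywhere equality *)
Definition aeeq (f g : G -> Mx) : Prop :=
  {ae mu, forall x : borel G, f x = g x}.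

(* integral of a complex valued function (real and imaginary parts) *)
Definition cint (h : G -> C) : C :=
  (Rintegral mu [set: borel G] (fun x => complex.Re (h x)))%:C
  + 'i * (Rintegral mu [set: borel G] (fun x => complex.Im (h x)))%:C.

(* matrix-valued inner product <f, g> = \int f(x) g(x)^* dmu  (s x s) *)
Definition mip (f g : G -> Mx) : 'M[C]_s :=
  \matrix_(i < s, k < s) \sum_(j < r) cint (fun x => f x i j * (g x k j)^*).

(* Hilbert space inner product <f, g>_{L^2} = tr <f, g> *)
Definition ip (f g : G -> Mx) : C := \tr (mip f g).

(* Frobenius norm on L^2 *)
Definition fnorm (f : G -> Mx) : R := Num.sqrt (complex.Re (ip f f)).

(* operators on L^2(G, C^{s x r}), acting on representatives *)
Definition op := (G -> Mx) -> (G -> Mx).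

(* well defined on L^2, linear and bounded *)
Definition bounded_linear (T : op) : Prop :=
  [/\ (forall f, L2 f -> L2 (T f)),
      (forall f g, L2 f -> L2 g -> aeeq f g -> aeeq (T f) (T g)),
      (forall (a : C) f g, L2 f -> L2 g ->
         aeeq (T (fun x => a *: f x + g x)) (fun x => a *: T f x + T g x)) &
      (exists c : R, forall f, L2 f -> fnorm (T f) <= c * fnorm f)].

(* bijective on L^2 (equality being a.e. equality) *)
Definition bijective_op (T : op) : Prop :=
  (forall f g, L2 f -> L2 g -> aeeq (T f) (T g) -> aeeq f g) /\
  (forall g, L2 g -> exists f, L2 f /\ aeeq (T f) g).

(* V is the Hilbert-adjoint of T:  <T f, g>_{L^2} = <f, V g>_{L^2} *)
Definition hilbert_adjoint (T V : op) : Prop :=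
  (forall g, L2 g -> L2 (V g)) /\
  (forall f g, L2 f -> L2 g -> ip (T f) g = ip f (V g)).

(* T is adjointable w.r.t. the matrix-valued inner product:
   <T f, g> = <f, T^* g> for all f, g *)
Definition mx_adjointable (T : op) : Prop :=
  exists V : op, (forall g, L2 g -> L2 (V g)) /\
    (forall f g, L2 f -> L2 g -> mip (T f) g = mip f (V g)).

(* Uinv is the inverse of U on L^2 *)
Definition inverse_op (U Uinv : op) : Prop :=
  (forall f, L2 f -> L2 (Uinv f)) /\
  (forall f, L2 f -> aeeq (U (Uinv f)) f /\ aeeq (Uinv (U f)) f).

(* T positive: T^* = T and tr <T f, f> >= 0 *)
Definition positive_op (T : op) : Prop :=
  hilbert_adjoint T T /\ (forall f, L2 f -> 0 <= ip (T f) f).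

(* matrix-valued orthonormal basis {E_k}_{k in N} *)
Definition mx_onb (E : nat -> G -> Mx) : Prop :=
  [/\ (forall k, L2 (E k)),
      (forall k j, mip (E k) (E j) = if k == j then 1%:M else 0) &
      (forall f, L2 f ->
         (fun n : nat => fnorm (fun x => f x - \sum_(k < n) (mip f (E k) *m E k x)))
           @ \oo --> (0 : R))].

End L2.

(* Main.v *)
(* If T is positive, then it is coercive: its inverse is selfadjoint, hence
   bounded (Hellinger-Toeplitz).  So T has a positive invertible square root S,
   obtained as the limit of an iteration of polynomials in T.  Left multiplication by a matrix
   commutes with T, hence with S, which makes S selfadjoint for the
   matrix-valued product as well; then U = T^-1 S = S^-1 and any orthonormal
   basis E satisfy T (U E_k) = S E_k = (U^-1)^* E_k.
   Conversely, let J be the inverse of U.  Operators adjointable for the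
   matrix-valued product commute with left multiplication by matrices, so
   T U E_k = J^* E_k propagates to the matrix combinations of the E_k, which are
   dense, whence T U = J^* and <T f, h> = <J f, J h>, a positive form. *)
Require Import Defs.
From HB Require Import structures.
From mathcomp Require Import all_boot all_order all_algebra.
From mathcomp Require Import all_classical all_reals all_analysis.
From mathcomp Require Import measurable_realfun complex ring lra.
Import Order.TTheory GRing.Theory Num.Theory.
Import numFieldNormedType.Exports.
Local Open Scope classical_set_scope.
Local Open Scope ring_scope.

Set Implicit Arguments.
Unset Strict Implicit.
Unset Printing Implicit Defensive.

(** * Square roots in a semi-definite complete space *)

Lemma le0_geometric (R : realType) (x C q : R) :
  0 <= q -> q < 1 -> (forall n, x <= C * q ^+ n) -> x <= 0.
Proof.
move=> q0 q1 h.
have cv : (fun n => C * q ^+ n) @ \oo --> C * 0.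
  by apply: cvgMl_tmp; apply: cvg_expr; rewrite ger0_norm.
rewrite -[leRHS](mulr0 C) -(cvg_lim _ cv)//.
apply: limr_ge; first by apply/cvg_ex; exists (C * 0).
by apply: nearW => n; exact: h.
Qed.

Lemma geometric_telescope (R : realType) (V : zmodType) (N : V -> R)
    (u : nat -> V) (c q : R) :
  N 0 = 0 -> (forall x y, N (x + y) <= N x + N y) -> 0 <= c -> 0 <= q -> q < 1 ->
  (forall n, N (u n.+1 - u n) <= c * q ^+ n) ->
  forall m n, N (u (m + n)%N - u n) <= c / (1 - q) * q ^+ n.
Proof.
move=> N0 ND c0 q0 q1 hu m n; have q1' : 0 < 1 - q by rewrite subr_gt0.
(* The induction on [m] carries the exact partial geometric sum; the weaker bound alone would not be
   inductive. *)
suff: N (u (m + n)%N - u n) <= c / (1 - q) * (q ^+ n - q ^+ (m + n)).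
  move=> /le_trans; apply; apply: ler_wpM2l; first by rewrite divr_ge0 // ltW.
  by rewrite gerBl exprn_ge0.
elim: m => [|m IH]; first by rewrite add0n !subrr mulr0 N0.
rewrite addSn -(subrK (u (m + n)%N) (u _.+1)) -addrA.
apply: le_trans (ND _ _) _; apply: le_trans (lerD (hu _) IH) _.
rewrite le_eqVlt; apply/orP; left; apply/eqP.
by rewrite exprS; field; rewrite gt_eqF.
Qed.

Section form.
Variables (R : realType) (V : lmodType R[i]) (b : V -> V -> R).

(* V is a complex module, but b is only required to be bilinear over R: it
   stands for the real part of a hermitian product. *)
Record psd_form : Prop := PsdForm {
  formC : forall f g, b f g = b g f;
  formDl : forall f g h, b (f + g) h = b f h + b g h;
  formZl : forall (a : R) f g, b (real_complex R a *: f) g = a * b f g;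
  form_ge0 : forall f, 0 <= b f f }.

Hypothesis bP : psd_form.

Lemma formDr f g h : b f (g + h) = b f g + b f h.
Proof. by rewrite formC // formDl // ![b f _]formC. Qed.

Lemma formZr a f g : b f (real_complex R a *: g) = a * b f g.
Proof. by rewrite formC // formZl // formC. Qed.

Lemma form0l g : b 0 g = 0.
Proof.
by rewrite -[X in b X](scale0r 0) -(rmorph0 (real_complex R)) formZl // mul0r.
Qed.

Lemma formNl f g : b (- f) g = - b f g.
Proof.
have -> : - f = real_complex R (-1) *: f by rewrite rmorphN1 scaleN1r.
by rewrite formZl // mulN1r.
Qed.

Lemma formNr f g : b f (- g) = - b f g.
Proof. by rewrite formC // formNl formC. Qed.

Lemma formBl f g h : b (f - g) h = b f h - b g h.
Proof. by rewrite formDl // formNl. Qed.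

Lemma formBr f g h : b f (g - h) = b f g - b f h.
Proof. by rewrite formDr formNr. Qed.

Lemma cauchy_schwarz_form f g : b f g ^+ 2 <= b f f * b g g.
Proof.
have Q t : 0 <= b f f + 2 * t * b f g + t ^+ 2 * b g g.
  have := form_ge0 bP (f + real_complex R t *: g).
  rewrite formDl // !formDr !formZl // !formZr (formC bP g f).
  by congr (_ <= _); ring.
have f0 := form_ge0 bP f; have := form_ge0 bP g.
rewrite le_eqVlt => /orP[/eqP g0|g0].
  have [->|fg0] := eqVneq (b f g) 0; first by rewrite expr0n mulr_ge0 // -g0.
  (* When [b g g = 0] the quadratic is affine in [t], and this [t] would give it the value -1; so
     [b f g] must vanish. *)
  have := Q (- (b f f + 1) / (2 * b f g)).
  rewrite -g0 mulr0 addr0.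
  have -> : 2 * (- (b f f + 1) / (2 * b f g)) * b f g = - (b f f + 1).
    by field.
  by lra.
(* The minimiser of the quadratic. *)
have := Q (- b f g / b g g).
have -> : b f f + 2 * (- b f g / b g g) * b f g + (- b f g / b g g) ^+ 2 * b g g
   = (b f f * b g g - b f g ^+ 2) / b g g.
  by field; rewrite gt_eqF.
by rewrite pmulr_lge0 ?invr_gt0 // subr_ge0.
Qed.

Definition hnorm f : R := Num.sqrt (b f f).

Lemma hnorm_ge0 f : 0 <= hnorm f.
Proof. exact: sqrtr_ge0. Qed.

Lemma sqr_hnorm f : hnorm f ^+ 2 = b f f.
Proof. by rewrite sqr_sqrtr // form_ge0. Qed.

Lemma form_le f g : `|b f g| <= hnorm f * hnorm g.
Proof.
rewrite -ler_sqr ?nnegrE ?mulr_ge0 ?hnorm_ge0 //.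
by rewrite real_normK ?num_real // exprMn !sqr_hnorm cauchy_schwarz_form.
Qed.

Lemma hnormD f g : hnorm (f + g) <= hnorm f + hnorm g.
Proof.
rewrite -ler_sqr ?nnegrE ?addr_ge0 ?hnorm_ge0 // sqr_hnorm.
rewrite formDl // !formDr (formC bP g f) -!sqr_hnorm.
have := le_trans (ler_norm _) (form_le f g); nra.
Qed.

Lemma hnormZ a f : hnorm (real_complex R a *: f) = `|a| * hnorm f.
Proof.
by rewrite /hnorm formZl // formZr mulrA -expr2 sqrtrM ?sqr_ge0 // sqrtr_sqr.
Qed.

Lemma hnormN f : hnorm (- f) = hnorm f.
Proof. by rewrite /hnorm formNl formNr opprK. Qed.

Lemma hnorm0 : hnorm 0 = 0.
Proof. by rewrite -[X in hnorm X](scale0r 0) -(rmorph0 (real_complex R)) hnormZ normr0 mul0r. Qed.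

Lemma hnormB f g : hnorm (f - g) = hnorm (g - f).
Proof. by rewrite -hnormN opprB. Qed.

Lemma hnorm_triangle g f h : hnorm (f - h) <= hnorm (f - g) + hnorm (g - h).
Proof. by have := hnormD (f - g) (g - h); rewrite addrA subrK. Qed.

Lemma hnorm_eq0P f : hnorm f = 0 <-> b f f = 0.
Proof. by rewrite -sqr_hnorm; split=> [->|/eqP]; rewrite ?expr0n // sqrf_eq0 => /eqP. Qed.

Lemma hnorm0_forml f g h : hnorm (f - g) = 0 -> b f h = b g h.
Proof.
move=> fg; apply/eqP; rewrite -subr_eq0 -formBl -normr_le0.
by rewrite (le_trans (form_le _ _)) // fg mul0r.
Qed.

Lemma eq_hnorm f g : (forall h, b f h = b g h) -> hnorm f = hnorm g.
Proof. by move=> fg; rewrite /hnorm fg formC // fg. Qed.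

(** The form may have null vectors, so vectors are compared modulo these by testing against every
    [h]. All operator identities below are stated in this weak sense. *)
Lemma hnorm0_formP f g : hnorm (f - g) = 0 <-> (forall h, b f h = b g h).
Proof.
split=> [fg h|h]; first exact: hnorm0_forml.
by apply/hnorm_eq0P; rewrite formBl h subrr.
Qed.

(** Completeness is asked only for sequences with geometrically small increments, the kind that the
    gliding hump and the square root iteration produce. *)
Definition geometrically_complete : Prop :=
  forall (u : nat -> V) (c q : R), 0 <= q -> q < 1 ->
    (forall n, hnorm (u n.+1 - u n) <= c * q ^+ n) ->
  exists l, (fun n => hnorm (u n - l)) @ \oo --> (0 : R).

Lemma geometrically_complete_bound (u : nat -> V) (c q : R) :
  geometrically_complete -> 0 <= q -> q < 1 ->
    (forall n, hnorm (u n.+1 - u n) <= c * q ^+ n) ->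
  exists l, forall n, hnorm (l - u n) <= c / (1 - q) * q ^+ n.
Proof.
move=> cpl q0 q1 hu; have [l hl] := cpl u c q q0 q1 hu.
have c0 : 0 <= c by have := hu 0%N; rewrite expr0 mulr1; exact/le_trans/hnorm_ge0.
exists l => n.
have bd m : hnorm (u (m + n)%N - u n) <= c / (1 - q) * q ^+ n.
  exact: geometric_telescope hnorm0 hnormD c0 q0 q1 hu m n.
have cv : (fun m => hnorm (u (m + n)%N - l)) @ \oo --> (0 : R).
  by rewrite -(cvg_shiftn n) in hl.
rewrite -subr_le0 -[leRHS](cvg_lim _ cv) //.
apply: limr_ge; first by apply/cvg_ex; exists (0 : R).
apply: nearW => m.
rewrite lerBlDr; apply: le_trans (hnorm_triangle (u (m + n)%N) _ _) _.
by rewrite lerD // hnormB.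
Qed.

Hypothesis complete : geometrically_complete.

(* Gliding hump: a selfadjoint operator that is unbounded on unit vectors h n
   makes all the functionals b (Q x) (h n) = b x (Q (h n)) large at a single
   point, which contradicts Cauchy-Schwarz. *)
Lemma hellinger_toeplitz (Q : V -> V) :
  (forall f g, b (Q f) g = b f (Q g)) ->
  exists2 c, 0 < c & forall f, hnorm (Q f) <= c * hnorm f.
Proof.
move=> Qsa; apply: contrapT => nbd.
have ex n : exists f, hnorm f = 1 /\
    forall x, `|b x f| <= hnorm (Q x) * 4 ^- n.
  (* The vector sought is [Q h], normalised, for an [h] stretched by more than 4^n: the product of
     [x] with [Q h] equals that of [Q x] with [h], and Cauchy-Schwarz yields the factor 4^-n. *)
  have [h hh] : exists h, 4 ^+ n * hnorm h < hnorm (Q h).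
    apply: contrapT => nex; apply: nbd; exists (4 ^+ n); first by rewrite exprn_gt0.
    by move=> f; rewrite leNgt; apply/negP => ?; apply: nex; exists f.
  have Qh0 : 0 < hnorm (Q h).
    by apply: le_lt_trans hh; rewrite mulr_ge0 ?hnorm_ge0 ?exprn_ge0.
  exists (real_complex R (hnorm (Q h))^-1 *: Q h); split.
    by rewrite hnormZ ger0_norm ?invr_ge0 ?hnorm_ge0 // mulVf ?gt_eqF.
  move=> x; rewrite formZr -Qsa normrM ger0_norm ?invr_ge0 ?hnorm_ge0 //.
  rewrite mulrC ler_pdivrMr //; apply: le_trans (form_le _ _) _.
  rewrite -mulrA ler_wpM2l ?hnorm_ge0 // mulrC ler_pdivlMr ?exprn_gt0 //.
  by rewrite mulrC ltW.
have [f hf] := choice ex.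
(* The sign makes the step of length 3^-n along [f n] reinforce the product of [u n] with [f n]
   instead of cancelling it. *)
pose s (y : R) : R := if 0 <= y then 1 else -1.
pose u := fix u n := if n is n'.+1 then
  u n' + real_complex R (s (b (u n') (f n')) * 3 ^- n') *: f n' else 0.
have u1 n : hnorm (u n.+1 - u n) <= 1 * (3^-1) ^+ n.
  rewrite /= addrAC subrr add0r hnormZ (hf n).1 mulr1 mul1r exprVn normrM.
  rewrite [`|_ ^-1|]ger0_norm ?invr_ge0 ?exprn_ge0 // ler_piMl ?invr_ge0 ?exprn_ge0 //.
  by rewrite /s; case: ifP; rewrite ?normrN normr1.
have u2 n : 3 ^- n <= `|b (u n.+1) (f n)|.
  rewrite /= formDl // formZl // -sqr_hnorm (hf n).1 expr1n mulr1 /s.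
  have p3 : 0 < 3 ^- n :> R by rewrite invr_gt0 exprn_gt0.
  case: ifP => [h|/negbT].
    by rewrite mul1r (le_trans _ (ler_norm _)) // lerDr.
  rewrite -ltNge => h; rewrite mulN1r -normrN opprB (le_trans _ (ler_norm _)) //.
  by rewrite lerDl oppr_ge0 ltW.
have q0 : 0 <= 3^-1 :> R by rewrite invr_ge0.
have q1 : 3^-1 < 1 :> R by rewrite invf_lt1 // ltr1n.
have [x hx] := geometrically_complete_bound complete q0 q1 u1.
(* The steps after the n-th have total length at most 3^-n / 2, so they destroy at most half of the
   gain made at step n. *)
have lb n : 2^-1 * 3 ^- n <= `|b x (f n)|.
  have e : b (u n.+1) (f n) = b x (f n) - b (x - u n.+1) (f n).
    by rewrite formBl subKr.
  have h1 := u2 n; rewrite e in h1.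
  have h2 : `|b (x - u n.+1) (f n)| <= 2^-1 * 3 ^- n.
    apply: le_trans (form_le _ _) _; rewrite (hf n).1 mulr1.
    apply: le_trans (hx _) _; rewrite exprVn exprSr invfM le_eqVlt; apply/orP; left.
    by apply/eqP; field; rewrite expf_neq0.
  have := ler_normB (b x (f n)) (b (x - u n.+1) (f n)).
  have -> : 2^-1 * 3 ^- n = 3 ^- n - 2^-1 * 3 ^- n :> R by field; rewrite expf_neq0.
  by rewrite lerBlDr => h3; apply: le_trans h1 (le_trans h3 _); rewrite lerD2l.
have : (2^-1 : R) <= 0.
  (* Comparing 3^-n / 2 with 4^-n times the norm of [Q x] bounds 1/2 by a multiple of (3/4)^n for
     every n. *)
  apply: (@le0_geometric _ _ (hnorm (Q x)) (3 / 4)); first by lra.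
    by lra.
  move=> n; have := le_trans (lb n) ((hf n).2 x).
  have -> : (3 / 4) ^+ n = 3 ^+ n * 4 ^- n :> R by rewrite exprMn exprVn.
  rewrite -ler_pdivlMr ?invr_gt0 ?exprn_gt0 // invrK => /le_trans; apply.
  by rewrite -!mulrA [3 ^+ n * _]mulrC.
by rewrite leNgt invr_gt0 ltr0n.
Qed.

(** * Visser iteration for the square root of 1 - A *)

Section visser.
Variables (A : V -> V) (q : R).
Hypotheses (q0 : 0 <= q) (q1 : q < 1).
Hypothesis A_sa : forall f g, b (A f) g = b f (A g).
Hypothesis A_bound : forall f, hnorm (A f) <= q * hnorm f.

(* Iteration towards the fixed point Y = (A + Y^2) / 2, that is, for
   (1 - Y)^2 = 1 - A. *)
Fixpoint visser (n : nat) (f : V) : V :=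
  if n is n'.+1 then real_complex R (2^-1) *: (A f + visser n' (visser n' f))
  else 0.

Lemma visser_sa n f g : b (visser n f) g = b f (visser n g).
Proof.
elim: n f g => [|n IH] f g /=.
  by rewrite form0l formC // form0l.
by rewrite formZl // formZr formDl // formDr A_sa !IH.
Qed.

Lemma visser_bound n f : hnorm (visser n f) <= q * hnorm f.
Proof.
elim: n f => [|n IH] f /=; first by rewrite hnorm0 mulr_ge0 ?hnorm_ge0.
rewrite hnormZ ger0_norm ?invr_ge0 // ler_pdivrMl //.
apply: le_trans (hnormD _ _) _.
rewrite mulr_natl mulr2n lerD //; apply: le_trans (IH _) _.
by rewrite ler_wpM2l //; apply: le_trans (IH _) _; rewrite ler_piMl ?hnorm_ge0 // ltW.
Qed.

(** Operators are bare functions here; having an adjoint makes them additive modulo null vectors,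
    since [Y] can be moved to the other side of the form. *)
Lemma sa_hnormB (Y : V -> V) : (forall f g, b (Y f) g = b f (Y g)) ->
  forall f g, hnorm (Y f - Y g) = hnorm (Y (f - g)).
Proof.
by move=> Ysa f g; apply: eq_hnorm => h; rewrite formBl !Ysa formBl.
Qed.

(** With Y and Z two consecutive iterates, Z^2 - Y^2 = (Z - Y) Z + Y (Z - Y). Both summands gain a
    factor [q] because the iterates have norm at most [q], and the factor 1/2 averages them. *)
Lemma visser_step n f :
  hnorm (visser n.+1 f - visser n f) <= q * hnorm f * q ^+ n.
Proof.
elim: n f => [|n IH] f.
  rewrite /= expr0 mulr1 subr0 addr0 hnormZ ger0_norm ?invr_ge0 //.
  by rewrite ler_pdivrMl // (le_trans (A_bound f)) // ler_peMl ?mulr_ge0 ?hnorm_ge0 // ler1n.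
set Y := visser n; set Z := visser n.+1.
have -> : visser n.+2 f - visser n.+1 f =
    real_complex R (2^-1) *: ((Z (Z f) - Y (Z f)) + (Y (Z f) - Y (Y f))).
  by rewrite /= -scalerBr; congr (_ *: _); rewrite opprD addrACA subrr add0r addrA subrK.
rewrite hnormZ ger0_norm ?invr_ge0 // ler_pdivrMl //.
apply: le_trans (hnormD _ _) _.
rewrite mulr_natl mulr2n lerD //.
  apply: le_trans (IH _) _; rewrite exprS mulrCA mulrA ler_wpM2r ?exprn_ge0 //.
  by rewrite mulrA -mulrA ler_wpM2l // visser_bound.
rewrite sa_hnormB; last exact: visser_sa.
apply: le_trans (visser_bound _ _) _.
by rewrite exprS mulrCA ler_wpM2l.
Qed.

(** Commutation with [B] is phrased through its adjoint [B'], which suits identities modulo null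
    vectors. The square of an iterate is handled by moving one factor across the form, commuting,
    and moving it back. *)
Lemma visser_commute (B B' : V -> V) :
  (forall f g, b (B f) g = b f (B' g)) ->
  (forall f g, b (A (B f)) g = b (A f) (B' g)) ->
  forall n f g, b (visser n (B f)) g = b (visser n f) (B' g).
Proof.
move=> BB' AB; elim=> [|n IH] f g.
  by rewrite /= !form0l.
rewrite /= !formZl // !formDl // AB; congr (_ * (_ + _)).
by rewrite visser_sa IH -BB' -visser_sa IH.
Qed.

(** [Y] is the pointwise limit of the iterates, with error of order q^n. Each property of the
    iterates passes to [Y] because the defect is bounded by a multiple of q^n for every n. The
    second clause says (1 - Y)^2 = 1 - A modulo null vectors. *)
Lemma visser_limit : exists Y : V -> V,
  [/\ forall f g, b (Y f) g = b f (Y g),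
      forall f, hnorm (f - Y f - Y (f - Y f) - (f - A f)) = 0,
      forall f, hnorm (Y f) <= q * hnorm f &
      forall B B', (forall f g, b (B f) g = b f (B' g)) ->
        (forall f g, b (A (B f)) g = b (A f) (B' g)) ->
        forall f g, b (Y (B f)) g = b (Y f) (B' g)].
Proof.
have ex f : exists l, forall n,
    hnorm (l - visser n f) <= q * hnorm f / (1 - q) * q ^+ n.
  exact: geometrically_complete_bound complete q0 q1 (visser_step ^~ f).
have [Y hY'] := choice ex; pose K := q / (1 - q).
have K0 : 0 <= K by rewrite divr_ge0 // subr_ge0 ltW.
have hY f n : hnorm (Y f - visser n f) <= K * hnorm f * q ^+ n.
  by rewrite /K [_ / _ * _]mulrAC; exact: hY'.
have eqg x y C : (forall n, `|x - y| <= C * q ^+ n) -> x = y :> R.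
  move=> h; apply/eqP; rewrite -subr_eq0 -normr_le0.
  exact: le0_geometric q0 q1 h.
have hb f g n : `|b (Y f) g - b (visser n f) g| <= K * hnorm f * hnorm g * q ^+ n.
  rewrite -formBl (le_trans (form_le _ _)) // mulrAC ler_wpM2r ?hnorm_ge0 //.
have Ysa f g : b (Y f) g = b f (Y g).
  apply: (@eqg _ _ (K * hnorm f * hnorm g + K * hnorm g * hnorm f)) => n.
  have h1 := hb f g n; have := hb g f n.
  rewrite [b (Y g) f]formC // [b (visser n g) f]formC // -visser_sa => h2.
  rewrite mulrDl (le_trans _ (lerD h1 h2)) //.
  by rewrite (le_trans _ (ler_normB _ _)) // opprB addrA subrK.
have Ybd f : hnorm (Y f) <= q * hnorm f.
  rewrite -subr_le0; apply: (@le0_geometric _ _ (K * hnorm f) _ q0 q1) => n.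
  rewrite lerBlDr -[Y f](subrK (visser n f)) (le_trans (hnormD _ _)) //.
  by rewrite lerD // ?hY ?visser_bound.
exists Y; split => // [f|B B' BB' AB f g]; last first.
  apply: (@eqg _ _ (K * hnorm (B f) * hnorm g + K * hnorm f * hnorm (B' g))) => n.
  have h1 := hb (B f) g n; have h2 := hb f (B' g) n.
  rewrite mulrDl (le_trans _ (lerD h1 h2)) //.
  by rewrite (visser_commute BB' AB) (le_trans _ (ler_normB _ _)) // opprB addrA subrK.
apply: le_anti; rewrite hnorm_ge0 andbT.
(* Expanding reduces the equation to A + Y^2 - 2 Y = 0. *)
have -> : hnorm (f - Y f - Y (f - Y f) - (f - A f)) =
    hnorm (A f + Y (Y f) - real_complex R 2 *: Y f).
  apply: eq_hnorm => h.
  have e : b (Y (f - Y f)) h = b (Y f) h - b (Y (Y f)) h.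
    by rewrite Ysa formBl -!Ysa.
  by rewrite !formBl e [b (_ + _) h]formDl // formZl //; ring.
apply: (@le0_geometric _ _ (2 * K * hnorm f + 2 * (K * hnorm f)) _ q0 q1) => n.
set Z := visser n.
(* By the recursion, A f = 2 Z' f - Z (Z f) with Z' the iterate after Z, so only differences between
   [Y] and its iterates remain. *)
have -> : A f + Y (Y f) - real_complex R 2 *: Y f =
    (Y (Y f) - Z (Z f)) - real_complex R 2 *: (Y f - visser n.+1 f).
  rewrite scalerBr /= scalerA -rmorphM mulfV // rmorph1 scale1r opprB.
  by rewrite -/Z [RHS]addrA [in RHS]addrACA addNr addr0 [Y (Y f) + _]addrC.
apply: le_trans (hnormD _ _) _; rewrite hnormN hnormZ mulrDl lerD //.
  apply: le_trans (hnorm_triangle (Z (Y f)) _ _) _.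
  rewrite (sa_hnormB (visser_sa n)).
  apply: le_trans (lerD (hY _ _) (visser_bound _ _)) _.
  have h1 := Ybd f; have h2 := hY f n; have h3 := hnorm_ge0 f.
  have hn : 0 <= q ^+ n by rewrite exprn_ge0.
  have h4 : hnorm (Y f) <= hnorm f by rewrite (le_trans h1) // ler_piMl // ltW.
  rewrite [2 * K]mulr_natl [K *+ 2]mulr2n !mulrDl lerD //.
    by rewrite ler_wpM2r // ler_wpM2l.
  by rewrite (le_trans _ h2) // ler_piMl ?hnorm_ge0 // ltW.
rewrite ger0_norm // -[leRHS]mulrA; apply: ler_wpM2l => //.
apply: le_trans (hY _ _) _.
rewrite exprS mulrCA ler_piMl ?(ltW q1) // mulr_ge0 ?exprn_ge0 //.
by rewrite mulr_ge0 ?hnorm_ge0.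
Qed.

End visser.

End form.

(** * Square roots of coercive and of positive invertible operators *)

Theorem positive_square_root (R : realType) (V : lmodType R[i])
    (b : V -> V -> R) (T : V -> V) (m : R) :
  psd_form b -> geometrically_complete b -> 0 < m ->
  (forall f g, b (T f) g = b f (T g)) ->
  (forall f, m * b f f <= b (T f) f) ->
  exists S : V -> V,
  [/\ forall f g, b (S f) g = b f (S g),
      forall f, hnorm b (S (S f) - T f) = 0 &
      forall B B', (forall f g, b (B f) g = b f (B' g)) ->
        (forall f g, b (T (B f)) g = b (T f) (B' g)) ->
        forall f g, b (S (B f)) g = b (S f) (B' g)].
Proof.
move=> bP complete m0 Tsa Tm.
have [M0 M0_gt0 hM0] := hellinger_toeplitz bP complete Tsa.
(* The maximum with [m] guarantees [q >= 0] below even if the form vanishes identically. Then A = 1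
   - T / M satisfies 0 <= A <= q as a form, and the root of T is sqrt M (1 - Y). *)
pose M := Num.max m M0.
have M_gt0 : 0 < M by rewrite lt_max m0.
have TM f : b (T f) f <= M * b f f.
  rewrite (le_trans (ler_norm _)) // (le_trans (form_le bP _ _)) //.
  rewrite -(sqr_hnorm bP) expr2 mulrA ler_wpM2r ?hnorm_ge0 //.
  by rewrite (le_trans (hM0 _)) // ler_wpM2r ?hnorm_ge0 // le_max lexx orbT.
pose q := 1 - m / M.
have q0 : 0 <= q by rewrite subr_ge0 ler_pdivrMr // mul1r le_max lexx.
have q1 : q < 1 by rewrite gtrBl divr_gt0.
pose A f := f - real_complex R M^-1 *: T f.
have bA f g : b (A f) g = b f g - M^-1 * b (T f) g by rewrite (formBl bP) formZl.
have Asa f g : b (A f) g = b f (A g).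
  by rewrite bA (formBr bP) (formZr bP) Tsa.
have Age0 f : 0 <= b (A f) f.
  by rewrite bA subr_ge0 ler_pdivrMl.
have Ale f : b (A f) f <= q * b f f.
  by rewrite bA mulrBl mul1r lerB // mulrAC -mulrC ler_pM2l ?invr_gt0.
have AP : psd_form (fun f g => b (A f) g).
  split => // [f g|f g h|a f g]; first by rewrite Asa formC.
    by rewrite Asa formDl // !Asa.
  by rewrite Asa formZl // Asa.
(* The form bounds become a norm bound by Cauchy-Schwarz for the form of [A] at [f] and [A f]: the
   fourth power of the norm of [A f] is at most <A f, f> <A (A f), A f>. *)
have Abd f : hnorm b (A f) <= q * hnorm b f.
  have [->|Af0] := eqVneq (hnorm b (A f)) 0; first by rewrite mulr_ge0 ?hnorm_ge0.
  have Af_gt0 : 0 < hnorm b (A f) by rewrite lt_def Af0 hnorm_ge0.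
  rewrite -(ler_pM2r Af_gt0) -ler_sqr ?nnegrE ?mulr_ge0 ?hnorm_ge0 //.
  rewrite -expr2 (sqr_hnorm bP) (le_trans (cauchy_schwarz_form AP f (A f))) //.
  have -> : (q * hnorm b f * hnorm b (A f)) ^+ 2 =
      (q * b f f) * (q * b (A f) (A f)) by rewrite !exprMn !(sqr_hnorm bP); ring.
  by rewrite ler_pM.
have [Y [Ysa Ysq Ybd Ycomm]] := visser_limit bP complete q0 q1 Asa Abd.
pose c := Num.sqrt M.
have cc : c * c = M by rewrite -expr2 sqr_sqrtr // ltW.
pose S f := real_complex R c *: (f - Y f).
have bS f g : b (S f) g = c * (b f g - b (Y f) g) by rewrite formZl // (formBl bP).
exists S; split.
- by move=> f g; rewrite bS (formZr bP) (formBr bP) Ysa.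
- move=> f; apply/(hnorm0_formP bP) => h.
  have Ylin a g k : b (Y (real_complex R a *: g)) k = a * b (Y g) k.
    by rewrite Ysa formZl // -Ysa.
  have := Ysq f; move=> /(hnorm0_formP bP)/(_ h).
  move=> e; have := e; rewrite (formBl bP) [RHS](formBl bP) bA [b (f - Y f) h](formBl bP) => {}e.
  by rewrite bS Ylin [b (S f) h]bS -mulrBr mulrA cc e; field; rewrite gt_eqF.
- move=> B B' BB' TB f g; rewrite !bS BB' (Ycomm B B' BB') // => f' g'.
  by rewrite !bA BB' TB.
Qed.

(** The inverse [Q] is selfadjoint, hence bounded by some c. Cauchy-Schwarz for the form of [T] at
    [f] and [Q f] gives <f, f>^2 <= <T f, f> <f, Q f> <= c <T f, f> <f, f>, so 1/c is a coercivity
    constant. *)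
Lemma positive_coercive (R : realType) (V : lmodType R[i]) (b : V -> V -> R)
    (T Q : V -> V) :
  psd_form b -> geometrically_complete b ->
  (forall f g, b (T f) g = b f (T g)) -> (forall f, 0 <= b (T f) f) ->
  (forall f g, b (T (Q f)) g = b f g) ->
  exists2 m, 0 < m & forall f, m * b f f <= b (T f) f.
Proof.
move=> bP complete Tsa T0 TQ.
have Qsa f g : b (Q f) g = b f (Q g).
  by rewrite -(TQ f) Tsa [b (Q f) (T _)]formC // TQ formC.
have [c c0 hc] := hellinger_toeplitz bP complete Qsa.
exists c^-1; first by rewrite invr_gt0.
move=> f; rewrite ler_pdivrMl //.
have := form_ge0 bP f; rewrite le_eqVlt => /orP[/eqP <-|f0].
  by rewrite mulr_ge0 // ltW.
have TP : psd_form (fun f g => b (T f) g).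
  split => // [g h|g h k|a g h]; first by rewrite Tsa formC.
    by rewrite Tsa formDl // !Tsa.
  by rewrite Tsa formZl // Tsa.
have := cauchy_schwarz_form TP f (Q f).
have -> : b (T f) (Q f) = b f f by rewrite Tsa formC // TQ.
rewrite TQ => h; rewrite -(ler_pM2r f0) -expr2 (le_trans h) //.
rewrite [c * _]mulrC -mulrA ler_wpM2l // (le_trans (ler_norm _)) //.
rewrite (le_trans (form_le bP _ _)) // -(sqr_hnorm bP) expr2 mulrCA.
by rewrite ler_wpM2l ?hnorm_ge0.
Qed.

Theorem positive_inverse_square_root (R : realType) (V : lmodType R[i])
    (b : V -> V -> R) (T Q : V -> V) :
  psd_form b -> geometrically_complete b ->
  (forall f g, b (T f) g = b f (T g)) -> (forall f, 0 <= b (T f) f) ->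
  (forall f g, b (T (Q f)) g = b f g) ->
  exists S U : V -> V,
  [/\ (forall f g, b (S f) g = b f (S g)) /\ (forall f g, b (U f) g = b f (U g)),
      forall f g, b (S (U f)) g = b f g,
      forall f g, b (U (S f)) g = b f g,
      forall f g, b (T (U f)) g = b (S f) g &
      forall B B', (forall f g, b (B f) g = b f (B' g)) ->
        (forall f g, b (T (B f)) g = b (T f) (B' g)) ->
        (forall f g, b (S (B f)) g = b (S f) (B' g)) /\
        (forall f g, b (U (B f)) g = b (U f) (B' g))].
Proof.
move=> bP complete Tsa T0 TQ.
have [m m0 mT] := positive_coercive bP complete Tsa T0 TQ.
have [S [Ssa SS Scomm]] := positive_square_root bP complete m0 Tsa mT.
have bSS f g : b (S (S f)) g = b (T f) g by exact: (hnorm0_formP bP _ _).1.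
have Qsa f g : b (Q f) g = b f (Q g).
  by rewrite -(TQ f) Tsa [b (Q f) (T _)]formC // TQ formC.
(* [Q] commutes with [T], hence with [S]; this makes [U = Q S] selfadjoint and a two-sided inverse
   of [S]. *)
have SQ f g : b (S (Q f)) g = b (S f) (Q g).
  by apply: Scomm => // f' g'; rewrite TQ Tsa [RHS]formC // TQ formC.
exists S, (fun f => Q (S f)); split.
- by split => // f g; rewrite Qsa -SQ Ssa.
- by move=> f g; rewrite SQ bSS Tsa formC // TQ formC.
- by move=> f g; rewrite Qsa bSS Tsa formC // TQ formC.
- by move=> f g; rewrite TQ.
- move=> B B' BB' TB; split => f g; first exact: Scomm.
  (* [Q] inherits commutation with [B] from [T]: insert [T Q] in front of [h], commute [T] past [B],
     and cancel [T] against the other [Q]. *)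
  have QB h k : b (B h) (Q k) = b (Q h) (B' k).
    rewrite BB' -(TQ h) -TB Tsa [LHS]formC // TQ formC // BB' //.
  by rewrite Qsa (Scomm B B') // -BB' QB.
Qed.

(** * Completeness of L2 *)

Lemma cvg_geometric_increments (R : realType) (x : nat -> R) (c q : R) :
  0 <= c -> 0 <= q -> q < 1 -> (forall n, `|x n.+1 - x n| <= c * q ^+ n) ->
  exists2 l, x @ \oo --> l & forall n, `|l - x n| <= c / (1 - q) * q ^+ n.
Proof.
move=> c0 q0 q1 hx.
have /cvg_ex[l hl] : cvgn x.
  have -> : x = (fun n => x 0%N + series (fun k => x k.+1 - x k) n).
    by apply/funext => n; rewrite /series /= telescope_sumr // addrC subrK.
  apply: is_cvgD; first exact: is_cvg_cst.
  apply: normed_cvg; apply: (@series_le_cvg _ _ (geometric c q)).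
  - by move=> n; exact: normr_ge0.
  - by move=> n; rewrite /geometric /= mulr_ge0 // exprn_ge0.
  - exact: hx.
  - by apply: is_cvg_geometric_series; rewrite ger0_norm.
exists l => // n.
have cv : (fun m => `|x (m + n)%N - x n|) @ \oo --> `|l - x n|.
  apply: cvg_norm; apply: cvgB; last exact: cvg_cst.
  by rewrite -(cvg_shiftn n) in hl.
rewrite -(cvg_lim _ cv) //.
apply: limr_le; first by apply/cvg_ex; exists `|l - x n|.
apply: nearW => m.
exact: geometric_telescope (@normr0 _ _) (@ler_normD _ _) c0 q0 q1 hx m n.
Qed.

Lemma cvg_EFin_comp (R : realType) (u : nat -> R) (l : R) :
  u @ \oo --> l -> (EFin \o u) @ \oo --> l%:E.
Proof. by move=> ul; apply: cvg_EFin => //; exact: nearW. Qed.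

Section square_integrable.
Context d (T : measurableType d) (R : realType) (mu : {measure set T -> \bar R}).
Implicit Types u v : T -> R.

Definition sqint u := measurable_fun [set: T] u /\
  mu.-integrable [set: T] (EFin \o (fun x => u x ^+ 2)).

Lemma sqintP u : measurable_fun [set: T] u ->
  (\int[mu]_x (u x ^+ 2)%:E < +oo)%E -> sqint u.
Proof.
move=> mu_ iu; split => //; apply/integrableP; split.
  by apply/measurable_EFinP; exact: measurable_funX.
by under eq_integral do rewrite /= ger0_norm ?sqr_ge0 //.
Qed.

Lemma sqint_mul u v : sqint u -> sqint v ->
  mu.-integrable [set: T] (EFin \o (fun x => u x * v x)).
Proof.
move=> [mu_ iu] [mv iv].
apply: (le_integrable _ _ _ (integrableD _ iu iv)) => //.
  by apply/measurable_EFinP; exact: measurable_funM.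
move=> x _; rewrite /= lee_fin [leRHS]ger0_norm ?addr_ge0 ?sqr_ge0 // normrM.
rewrite -[u x ^+ 2]real_normK ?num_real // -[v x ^+ 2]real_normK ?num_real //.
have := normr_ge0 (u x); have := normr_ge0 (v x); nra.
Qed.

Lemma sqintD u v : sqint u -> sqint v -> sqint (fun x => u x + v x).
Proof.
move=> su sv; split; first exact: measurable_funD su.1 sv.1.
have := integrableD measurableT su.2 (integrableD measurableT sv.2
  (integrableZl measurableT 2 (sqint_mul su sv))).
apply: eq_integrable => // x _; rewrite /= -!EFinM -!EFinD; congr EFin; ring.
Qed.

Lemma sqintZ (a : R) u : sqint u -> sqint (fun x => a * u x).
Proof.
move=> su; split; first exact: measurable_funM (measurable_cst _) su.1.
apply: eq_integrable (integrableZl measurableT (a ^+ 2) su.2) => // x _.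
by rewrite /= -EFinM exprMn.
Qed.

Lemma sqintB u v : sqint u -> sqint v -> sqint (fun x => u x - v x).
Proof.
move=> su sv; have := sqintD su (sqintZ (-1) sv).
by under eq_fun do rewrite mulN1r.
Qed.

Lemma sqint0 : sqint (fun=> 0).
Proof.
by split; first exact: measurable_cst; under eq_fun do rewrite /= expr0n; exact: integrable0.
Qed.

Lemma sqint_ae0 u : sqint u -> \int[mu]_x (u x ^+ 2) = 0 ->
  {ae mu, forall x, u x = 0}.
Proof.
move=> su u0.
have : (\int[mu]_x `|(u x ^+ 2)%:E| = 0)%E.
  under eq_integral do rewrite /= ger0_norm ?sqr_ge0 //.
  rewrite -[LHS]fineK; first by congr EFin; exact: u0.
  exact: (integrable_fin_num _ su.2).
move=> /(ae_eq_integral_abs _ measurableT (measurable_int _ su.2)).1.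
by apply: filterS => x /(_ I) /= [] /eqP; rewrite sqrf_eq0 => /eqP.
Qed.

(* The weighted sum h of the squared increments has finite integral, and at
   every point where h is finite the sequence converges geometrically. *)
Lemma sqint_complete (u : nat -> T -> R) (c q : R) :
  0 < q -> q < 1 -> (forall n, sqint (u n)) ->
  (forall n, \int[mu]_x ((u n.+1 x - u n x) ^+ 2) <= c * q ^+ n) ->
  exists l, sqint l /\
    exists K, forall n, \int[mu]_x ((l x - u n x) ^+ 2) <= K * Num.sqrt q ^+ n.
Proof.
(* The decay q^n is split as a^n a^n: one factor pays for the weight a^-n in [D] and leaves a
   summable series of integrals, the other gives the pointwise rate, which is r^n after taking
   square roots. *)
move=> q0 q1 su hu; pose a := Num.sqrt q; pose r := Num.sqrt a.
have a0 : 0 < a by rewrite sqrtr_gt0.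
have aa : a * a = q by rewrite -expr2 sqr_sqrtr // ltW.
have a1 : a < 1 by nra.
have r0 : 0 < r by rewrite sqrtr_gt0.
have rr : r ^+ 2 = a by rewrite sqr_sqrtr // ltW.
have r1 : r < 1 by nra.
have c0 : 0 <= c.
  have := hu 0%N; rewrite expr0 mulr1; apply: le_trans.
  by apply: Rintegral_ge0 => x _; rewrite sqr_ge0.
pose D n x := a ^- n * (u n.+1 x - u n x) ^+ 2.
have D0 n x : 0 <= D n x by rewrite mulr_ge0 ?sqr_ge0 // invr_ge0 exprn_ge0 // ltW.
have sD n : sqint (fun x => u n.+1 x - u n x) by exact: sqintB.
have iD n : mu.-integrable setT (EFin \o D n).
  have := integrableZl measurableT (a ^- n) (sD n).2.
  by apply: eq_integrable => // x _; rewrite /= -EFinM.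
have mD n : measurable_fun [set: T] (EFin \o D n) := measurable_int _ (iD n).
pose h x : \bar R := (\sum_(n <oo) (D n x)%:E)%E.
have mh : measurable_fun [set: T] h.
  by apply: ge0_emeasurable_sum => [n x _ _|n _]; [rewrite lee_fin|exact: mD].
have h0 x : (0 <= h x)%E by apply: nneseries_ge0 => n _ _; rewrite lee_fin.
have ih : (\int[mu]_x h x <= (c / (1 - a))%:E)%E.
  rewrite integral_nneseries //; last by move=> n x _; rewrite lee_fin.
  have bD n : (\int[mu]_x (D n x)%:E <= (geometric c a n)%:E)%E.
    rewrite -[leLHS]fineK; last exact: integrable_fin_num (iD n).
    rewrite lee_fin.
    have -> : fine (\int[mu]_x (D n x)%:E) = a ^- n * \int[mu]_x ((u n.+1 x - u n x) ^+ 2).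
      by rewrite -RintegralZl //; exact: (sD n).2.
    rewrite mulrC ler_pdivrMr ?exprn_gt0 // /geometric /= -mulrA -exprMn aa.
    exact: hu.
  apply: le_trans (lee_nneseries _ (fun n _ => bD n)) _.
    by move=> n _ _; apply: integral_ge0 => x _; rewrite lee_fin.
  have na : `|a| < 1 by rewrite ger0_norm // ltW.
  have cg := @cvg_geometric_series R c a na.
  rewrite le_eqVlt; apply/orP; left; apply/eqP.
  apply/cvg_lim => //.
  rewrite [X in X @ _ --> _](_ : _ = EFin \o series (geometric c a)).
    exact: cvg_EFin_comp.
  by apply/funext => n; rewrite /= /series /= sumEFin.
(* The upper limit is measurable whether or not the sequence converges; [fine] replaces infinite
   values by 0. *)
pose l x := fine (limn_esup (fun n => (u n x)%:E)).
have ml : measurable_fun [set: T] l.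
  apply: (@measurableT_comp _ _ _ _ _ _ fine) => //.
  apply: measurable_fun_limn_esup => n; apply/measurable_EFinP; exact: (su n).1.
pose k n := a ^+ n / (1 - r) ^+ 2.
have k0 n : 0 < k n by rewrite divr_gt0 ?exprn_gt0 // subr_gt0.
(* The bound holds at every point: where [h] is infinite its right-hand side is infinite, as
   [k n > 0]. *)
have bl n x : (((l x - u n x) ^+ 2)%:E <= (k n)%:E * h x)%E.
  move: (h0 x); case hxy: (h x) => [y||] // y0; last first.
    by rewrite gt0_muley ?lte_fin // leey.
  have Dy m : D m x <= y.
    rewrite -lee_fin -hxy /h (@nneseriesD1 _ _ m) //= => [|i _].
      by rewrite leeDl // nneseries_ge0 // => i _ _; rewrite lee_fin.
    by rewrite lee_fin.
  have inc m : `|u m.+1 x - u m x| <= Num.sqrt y * r ^+ m.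
    rewrite lee_fin in y0.
    rewrite -ler_sqr ?nnegrE ?mulr_ge0 ?sqrtr_ge0 ?exprn_ge0 ?sqrtr_ge0 //.
    rewrite real_normK ?num_real // exprMn sqr_sqrtr // exprAC rr.
    by have := Dy m; rewrite /D mulrC ler_pdivrMr ?exprn_gt0.
  have [z hz zb] := cvg_geometric_increments (sqrtr_ge0 y) (ltW r0) r1 inc.
  have -> : l x = z.
    rewrite /l is_cvg_limn_esupE; last by apply/cvg_ex; exists z%:E; exact: cvg_EFin_comp.
    have /cvg_lim -> // : ((fun n => (u n x)%:E) @ \oo --> z%:E)%E.
    exact: cvg_EFin_comp.
  rewrite -EFinM lee_fin -[leLHS]real_normK ?num_real //.
  apply: le_trans (_ : (Num.sqrt y / (1 - r) * r ^+ n) ^+ 2 <= _).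
    by rewrite ler_sqr ?nnegrE // (le_trans _ (zb n)).
  rewrite lee_fin in y0.
  rewrite !exprMn sqr_sqrtr // exprVn exprAC rr /k le_eqVlt; apply/orP; left.
  by apply/eqP; ring.
have il n : (\int[mu]_x ((l x - u n x) ^+ 2)%:E <= (k n)%:E * \int[mu]_x h x)%E.
  rewrite -ge0_integralZl_EFin //; last exact: ltW.
  apply: ge0_le_integral => //.
  - by move=> x _; rewrite lee_fin sqr_ge0.
  - apply/measurable_EFinP; apply: measurable_funX; apply: measurable_funB => //.
    exact: (su n).1.
  - exact: measurable_funeM.
have il' n : (\int[mu]_x ((l x - u n x) ^+ 2)%:E <= (k n * (c / (1 - a)))%:E)%E.
  by rewrite (le_trans (il n)) // [leRHS]EFinM lee_wpmul2l // lee_fin ltW.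
have sl n : sqint (fun x => l x - u n x).
  apply: sqintP; first exact: measurable_funB ml (su n).1.
  by apply: le_lt_trans (il' n) _; rewrite ltry.
exists l; split.
  have := sqintD (sl 0%N) (su 0%N).
  by under eq_fun do rewrite subrK.
exists (c / (1 - a) / (1 - r) ^+ 2) => n.
rewrite -lee_fin /Rintegral fineK; last exact: (integrable_fin_num _ (sl n).2).
apply: le_trans (il' n) _; rewrite lee_fin le_eqVlt; apply/orP; left.
by apply/eqP; rewrite /k -/a; ring.
Qed.

End square_integrable.

(** * The matrix-valued inner product *)

Section part.
Variable R : realType.
Implicit Types z w : R[i].

(** Indexing the two real coordinates by a boolean lets one argument serve for both. *)
Definition part (c : bool) z : R := if c then complex.Im z else complex.Re z.

Lemma eq_part z w : (forall c, part c z = part c w) -> z = w.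
Proof. by case: z w => [a b] [c d] e; rewrite -(e false : a = c) -(e true : b = d). Qed.

Lemma partD c z w : part c (z + w) = part c z + part c w.
Proof. by case: c z w => [] [] ? ? []. Qed.

Lemma partN c z : part c (- z) = - part c z.
Proof. by case: c z => [] []. Qed.

Lemma part0 c : part c (0 : R[i]) = 0.
Proof. by case: c. Qed.

Lemma part_sum c (I : finType) (F : I -> R[i]) :
  part c (\sum_i F i) = \sum_i part c (F i).
Proof. exact: (big_morph _ (partD c) (part0 c)). Qed.

Lemma partM c z w : part c (z * w) =
  part false z * part c w + (-1) ^+ (~~ c) * part true z * part (~~ c) w.
Proof. by case: c z w => [] [a b] [e f] /=; rewrite ?expr0 ?expr1; ring. Qed.

Lemma part_conj c z : part c z^* = (-1) ^+ c * part c z.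
Proof. by case: c z => [] [a b] /=; rewrite ?expr0 ?expr1 ?mul1r ?mulN1r. Qed.

Lemma mxtrace_conjT (s : nat) (M : 'M[R[i]]_s) :
  \tr (\matrix_(i, j) (M j i)^*) = (\tr M)^*.
Proof. by rewrite /mxtrace rmorph_sum; apply: eq_bigr => i _; rewrite mxE. Qed.

End part.

Section complex_integral.
Variables (R : realType) (G : topologicalZmodType)
  (mu : {measure set (borel G) -> \bar R}).
Implicit Types h k : G -> R[i].

Definition cintegrable h := forall c, mu.-integrable [set: borel G]
  (EFin \o (fun x : borel G => part c (h x))).

Lemma part_cint c h :
  part c (cint mu h) = Rintegral mu [set: borel G] (fun x => part c (h x)).
Proof. by case: c; rewrite /part /cint /=; ring. Qed.

Lemma cintegrableD h k : cintegrable h -> cintegrable k ->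
  cintegrable (fun x => h x + k x).
Proof.
move=> hi ki c; apply: eq_integrable (integrableD measurableT (hi c) (ki c)) => //.
by move=> x _; rewrite /= partD.
Qed.

Lemma cintegrableZ z h : cintegrable h -> cintegrable (fun x => z * h x).
Proof.
move=> hi c; apply: eq_integrable (integrableD measurableT
  (integrableZl measurableT (part false z) (hi c))
  (integrableZl measurableT ((-1) ^+ (~~ c) * part true z) (hi (~~ c)))) => //.
by move=> x _; rewrite /= partM.
Qed.

Lemma cint0 : cint mu (fun=> 0) = 0.
Proof.
by apply: eq_part => c; rewrite part_cint part0 Rintegral_cst // mul0r.
Qed.

Lemma cintegrable0 : cintegrable (fun=> 0).
Proof. by move=> c; under eq_fun do rewrite /= part0; exact: integrable0. Qed.

Lemma cintD h k : cintegrable h -> cintegrable k ->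
  cint mu (fun x => h x + k x) = cint mu h + cint mu k.
Proof.
move=> hi ki; apply: eq_part => c; rewrite partD !part_cint.
by rewrite -RintegralD //; apply: eq_Rintegral => x _; rewrite partD.
Qed.

Lemma cintZ z h : cintegrable h -> cint mu (fun x => z * h x) = z * cint mu h.
Proof.
move=> hi; apply: eq_part => c; rewrite partM !part_cint.
have := RintegralD measurableT
  (integrableZl measurableT (part false z) (hi c))
  (integrableZl measurableT ((-1) ^+ (~~ c) * part true z) (hi (~~ c))).
rewrite /= !RintegralZl // => <-.
by apply: eq_Rintegral => x _; rewrite partM.
Qed.

Lemma cint_sum (I : finType) (F : I -> G -> R[i]) :
  (forall i, cintegrable (F i)) ->
  cint mu (fun x => \sum_i F i x) = \sum_i cint mu (F i).
Proof.
move=> Fi; suff [] : cintegrable (fun x => \sum_i F i x) /\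
  cint mu (fun x => \sum_i F i x) = \sum_i cint mu (F i) by [].
elim: (index_enum I) => [|i l [IH1 IH2]].
  under eq_fun do rewrite big_nil; rewrite big_nil; split; last exact: cint0.
  exact: cintegrable0.
under eq_fun do rewrite big_cons; rewrite big_cons -IH2; split.
  exact: cintegrableD.
exact: cintD.
Qed.

Lemma cint_conj h : cintegrable h -> cint mu (fun x => (h x)^*) = (cint mu h)^*.
Proof.
move=> hi; apply: eq_part => c; rewrite part_conj !part_cint -RintegralZl //.
by apply: eq_Rintegral => x _; rewrite part_conj.
Qed.

End complex_integral.

Section matrix_valued_L2.
Variables (R : realType) (G : topologicalZmodType)
  (mu : {measure set (borel G) -> \bar R}) (s r : nat).
Local Notation Mx := 'M[R[i]]_(s, r).
Implicit Types f g : G -> Mx.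
Local Notation entry c f i j := (fun x : borel G => part c (f x i j)).

Lemma L2P f : L2 mu f <-> forall i j c, sqint mu (entry c f i j).
Proof.
split=> [Lf i j c|Sf i j].
  have [mR mI fin] := Lf i j.
  have mc : measurable_fun setT (entry c f i j) by case: c.
  apply: sqintP => //; apply: le_lt_trans fin; apply: ge0_le_integral => //.
  - by move=> x _; rewrite lee_fin sqr_ge0.
  - by apply/measurable_EFinP; exact: measurable_funX.
  - by apply/measurable_EFinP; apply: measurable_funD; exact: measurable_funX.
  - move=> x _; rewrite lee_fin /cnormsq /part.
    by case: c {mc}; rewrite ?lerDl ?lerDr sqr_ge0.
have [mR iR] := Sf i j false; have [mI iI] := Sf i j true.
split => //; have := integrable_lty measurableT (integrableD measurableT iR iI).
by under eq_integral do rewrite /= -EFinD.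
Qed.

Lemma L2_submod_closed :
  L2 mu (0 : G -> Mx) /\
  forall (a : R[i]) f g, L2 mu f -> L2 mu g -> L2 mu (a *: f + g).
Proof.
split=> [|a f g /L2P Lf /L2P Lg]; apply/L2P => i j c.
  by under eq_fun do rewrite /= mxE part0; exact: sqint0.
under eq_fun do rewrite /= !mxE partD partM.
by apply: sqintD => //; apply: sqintD; exact: sqintZ.
Qed.

Lemma sqint_sum (I : finType) (F : I -> borel G -> R) :
  (forall i, sqint mu (F i)) -> sqint mu (fun x => \sum_i F i x).
Proof.
move=> SF; elim: (index_enum I) => [|i l IH].
  by under eq_fun do rewrite big_nil; exact: sqint0.
by under eq_fun do rewrite big_cons; exact: sqintD.
Qed.

Lemma L2_mulmx (A : 'M[R[i]]_s) f : L2 mu f -> L2 mu (fun x => A *m f x).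
Proof.
move=> /L2P Lf; apply/L2P => i j c.
under eq_fun do rewrite mxE part_sum; apply: sqint_sum => l.
under eq_fun do rewrite partM.
by apply: sqintD; exact: sqintZ.
Qed.

Lemma cintegrable_mul f g i j k l : L2 mu f -> L2 mu g ->
  cintegrable mu (fun x => f x i j * (g x k l)^*).
Proof.
move=> /L2P Lf /L2P Lg c.
apply: eq_integrable (integrableD measurableT
  (integrableZl measurableT ((-1) ^+ c) (sqint_mul (Lf i j false) (Lg k l c)))
  (integrableZl measurableT ((-1) ^+ (~~ c) * (-1) ^+ (~~ c))
     (sqint_mul (Lf i j true) (Lg k l (~~ c))))) => //.
by move=> x _; rewrite /= partM !part_conj -!EFinM -EFinD; congr EFin; ring.
Qed.

Lemma mipDl f g h : L2 mu f -> L2 mu g -> L2 mu h ->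
  mip mu (fun x => f x + g x) h = mip mu f h + mip mu g h.
Proof.
move=> Lf Lg Lh; apply/matrixP => i k; rewrite !mxE -big_split /=.
apply: eq_bigr => j _; rewrite -cintD; try exact: cintegrable_mul.
by congr cint; apply/funext => x; rewrite mxE mulrDl.
Qed.

Lemma mip_mulmx (A : 'M[R[i]]_s) f g : L2 mu f -> L2 mu g ->
  mip mu (fun x => A *m f x) g = A *m mip mu f g.
Proof.
move=> Lf Lg; apply/matrixP => i k; rewrite !mxE.
under [RHS]eq_bigr do rewrite mxE big_distrr.
rewrite exchange_big /=; apply: eq_bigr => j _.
transitivity (\sum_l cint mu (fun x => A i l * (f x l j * (g x k j)^*))).
  rewrite -cint_sum => [|l]; last by apply: cintegrableZ; exact: cintegrable_mul.
  congr cint; apply/funext => x; rewrite mxE big_distrl; apply: eq_bigr => l _.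
  by rewrite /= mulrA.
by apply: eq_bigr => l _; rewrite cintZ //; exact: cintegrable_mul.
Qed.

Lemma mip_conj f g : L2 mu f -> L2 mu g ->
  mip mu g f = \matrix_(i, k) (mip mu f g k i)^*.
Proof.
move=> Lf Lg; apply/matrixP => i k; rewrite !mxE rmorph_sum /=.
apply: eq_bigr => j _; rewrite -cint_conj; last exact: cintegrable_mul.
by congr cint; apply/funext => x; rewrite rmorphM /= conjCK mulrC.
Qed.

Lemma ip_conj f g : L2 mu f -> L2 mu g -> ip mu g f = (ip mu f g)^*.
Proof. by move=> Lf Lg; rewrite /ip (mip_conj Lf Lg) mxtrace_conjT. Qed.

Lemma Re_ip_self f : L2 mu f -> complex.Re (ip mu f f) =
  \sum_i \sum_j \sum_c \int[mu]_x (entry c f i j x ^+ 2).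
Proof.
move=> Lf; rewrite -/(part false _) part_sum; apply: eq_bigr => i _.
rewrite mxE part_sum; apply: eq_bigr => j _.
have Sf c := ((L2P f).1 Lf i j c).2.
rewrite part_cint big_bool [RHS]addrC -RintegralD //.
apply: eq_Rintegral => x _; rewrite partM !part_conj /=; ring.
Qed.

Lemma ip_mulmxr (A : 'M[R[i]]_s) f g : L2 mu f -> L2 mu g ->
  ip mu f (fun x => A *m g x) = ip mu (fun x => (\matrix_(i, j) (A j i)^*) *m f x) g.
Proof.
move=> Lf Lg; rewrite (ip_conj (L2_mulmx A Lg) Lf) /ip !mip_mulmx //.
rewrite (mip_conj Lg Lf) -mxtrace_conjT [RHS]mxtrace_mulC /mxtrace.
apply: eq_bigr => i _; rewrite !mxE rmorph_sum; apply: eq_bigr => j _.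
by rewrite !mxE rmorphM mulrC.
Qed.

Lemma ip_self0 f : L2 mu f -> complex.Re (ip mu f f) = 0 <-> aeeq mu f 0.
Proof.
move=> Lf; have Sf := (L2P f).1 Lf; split.
  rewrite Re_ip_self // => e0.
  have {}e0 i j c : \int[mu]_x (entry c f i j x ^+ 2) = 0.
    have ge c' i' j' : 0 <= \int[mu]_x (entry c' f i' j' x ^+ 2).
      by apply: Rintegral_ge0 => x _; exact: sqr_ge0.
    move/eqP: e0; rewrite psumr_eq0 => [|i' _]; last by do 2 apply: sumr_ge0 => ? _.
    move=> /allP/(_ i (mem_index_enum _))/=; rewrite psumr_eq0 => [|j' _]; last by apply: sumr_ge0.
    move=> /allP/(_ j (mem_index_enum _))/=; rewrite psumr_eq0 // => /allP/(_ c (mem_index_enum _))/=.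
    by move/eqP.
  have : {ae mu, forall x, forall i j c, entry c f i j x = 0}.
    do 3 (apply: filter_forall => ?); exact: sqint_ae0.
  apply: filterS => x h; apply/matrixP => i j; rewrite mxE.
  by apply: eq_part => c; rewrite part0 h.
move=> f0; rewrite Re_ip_self //.
apply: big1 => i _; apply: big1 => j _; apply: big1 => c _.
rewrite /Rintegral (ae_eq_integral (cst 0)) ?integral0 //.
  by apply/measurable_EFinP; apply: measurable_funX; exact: (Sf i j c).1.
by apply: filterS f0 => x /= -> _; rewrite mxE part0 expr0n.
Qed.

(** Taking for A a scalar z times a matrix unit isolates z times one entry; z = 1 reads off its real
    part and z = -i its imaginary part. *)
Lemma eq_mx_Re_trace (M N : 'M[R[i]]_s) :
  (forall A : 'M[R[i]]_s, complex.Re (\tr (A *m M)) = complex.Re (\tr (A *m N))) ->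
  M = N.
Proof.
have trd (z : R[i]) (P : 'M[R[i]]_s) i k : \tr ((z *: delta_mx k i) *m P) = z * P i k.
  rewrite -scalemxAl mxtraceZ -(mul_delta_mx (0 : 'I_1)) -mulmxA -rowE.
  by rewrite mxtrace_mulC -colE /mxtrace big_ord1 !mxE.
move=> MN; apply/matrixP => i k; apply: eq_part => -[] /=.
  have := MN (Complex 0 (-1) *: delta_mx k i); rewrite !trd.
  by case: (M i k) (N i k) => [a b] [c d] /=; rewrite !mul0r !mulN1r !opprK !add0r.
by have := MN (1 *: delta_mx k i); rewrite !trd !mul1r.
Qed.

End matrix_valued_L2.

(** * L2 as a complex module with a complete semi-definite real form *)

Section L2_space.
Variables (R : realType) (G : topologicalZmodType)
  (mu : {measure set (borel G) -> \bar R}) (s r : nat).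
Local Notation Mx := 'M[R[i]]_(s, r).

Definition L2_pred : {pred G -> Mx} := fun f => `[< L2 mu f >].

Lemma L2_pred_submod_closed : submod_closed L2_pred.
Proof.
have [L0 LD] := L2_submod_closed mu s r.
split=> [|a f g /asboolP Lf /asboolP Lg]; first exact/asboolP.
exact/asboolP/LD.
Qed.

HB.instance Definition _ := GRing.isSubmodClosed.Build _ _ L2_pred
  L2_pred_submod_closed.

(** Elements are functions, not classes; the null vectors of [L2_form] are the functions that vanish
    almost everywhere. *)
Record L2_space := MkL2 { L2_fun : G -> Mx; L2_funP : L2_fun \in L2_pred }.

HB.instance Definition _ := [isSub for L2_fun].
HB.instance Definition _ := [Choice of L2_space by <:].
HB.instance Definition _ := [SubChoice_isSubLmodule of L2_space by <:].

Implicit Types f g h : L2_space.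

Lemma L2_val f : L2 mu (val f).
Proof. exact/asboolP/(L2_funP f). Qed.
Hint Resolve L2_val : core.

Definition mkL2 (f : G -> Mx) (Lf : L2 mu f) : L2_space := MkL2 (asboolT Lf).

Lemma L2_lift (f : G -> Mx) : L2 mu f -> exists F : L2_space, f = val F.
Proof. by move=> Lf; exists (mkL2 Lf). Qed.

Definition L2_form f g : R := complex.Re (ip mu (val f) (val g)).

Definition mact (A : 'M[R[i]]_s) f : L2_space := mkL2 (L2_mulmx A (L2_val f)).

Definition mxconj (A : 'M[R[i]]_s) : 'M[R[i]]_s := \matrix_(i, j) (A j i)^*.

Lemma mxconjK A : mxconj (mxconj A) = A.
Proof. by apply/matrixP => i j; rewrite !mxE conjCK. Qed.

Lemma scale_mact (a : R[i]) f : a *: f = mact a%:M f.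
Proof. by apply: val_inj; apply/funext => x; rewrite /= mul_scalar_mx. Qed.

Lemma L2_form_mact A f g : L2_form (mact A f) g = L2_form f (mact (mxconj A) g).
Proof.
rewrite /L2_form (ip_mulmxr (mxconj A) (L2_val f) (L2_val g)).
by rewrite -/(mxconj (mxconj A)) mxconjK.
Qed.

Lemma L2_form_mactE A f g :
  L2_form (mact A f) g = complex.Re (\tr (A *m mip mu (val f) (val g))).
Proof. by rewrite /L2_form /ip mip_mulmx. Qed.

Lemma L2_formP : psd_form L2_form.
Proof.
split=> [f g|f g h|a f g|f].
- by rewrite /L2_form (ip_conj (L2_val g) (L2_val f)) -/(part false _^*) part_conj mul1r.
- by rewrite /L2_form /ip mipDl // mxtraceD -/(part false _) partD.
- rewrite scale_mact L2_form_mactE mul_scalar_mx mxtraceZ -/(part false _).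
  by rewrite partM /= mulr0 mul0r addr0.
- rewrite /L2_form Re_ip_self //; do 3 (apply: sumr_ge0 => ? _).
  by apply: Rintegral_ge0 => x _; exact: sqr_ge0.
Qed.
Let bP := L2_formP.

Lemma aeeqP f g : aeeq mu (val f) (val g) <-> forall h, L2_form f h = L2_form g h.
Proof.
rewrite -hnorm0_formP // (hnorm_eq0P bP) /L2_form ip_self0 //.
have e x : val (f - g) x = val f x - val g x by [].
split; apply: filterS => x; rewrite e; first by move=> ->; rewrite subrr.
by move/eqP; rewrite subr_eq0 => /eqP.
Qed.

(** Left multiplication by A enters the trace as a factor, so the scalar real form, tested with all
    A, determines the whole matrix-valued product. *)
Lemma mip_ext f g f' g' :
  (forall A, L2_form (mact A f) g = L2_form (mact A f') g') ->
  mip mu (val f) (val g) = mip mu (val f') (val g').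
Proof. by move=> e; apply: eq_mx_Re_trace => A; rewrite -!L2_form_mactE. Qed.

Lemma part_entry_le f i j c :
  \int[mu]_x (part c (val f x i j) ^+ 2) <= L2_form f f.
Proof.
have ge c' i' j' : 0 <= \int[mu]_x (part c' (val f x i' j') ^+ 2).
  by apply: Rintegral_ge0 => x _; exact: sqr_ge0.
rewrite /L2_form Re_ip_self // (bigD1 i) //= (bigD1 j) //= (bigD1 c) //= -!addrA lerDl.
rewrite !addr_ge0 //; do ?(apply: sumr_ge0 => ? _) => //.
Qed.

Lemma L2_form_complete : geometrically_complete L2_form.
Proof.
move=> u c q0' q00 q01 hu0.
(* [sqint_complete] asks for a strictly positive ratio. It is applied to each real coordinate of
   each entry with ratio q^2, because it measures squared increments. *)
pose q := Num.max q0' 2^-1.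
have q0 : 0 < q by rewrite lt_max invr_gt0 ltr0n orbT.
have q1 : q < 1 by rewrite gt_max q01 invf_lt1 // ltr1n.
have c0 : 0 <= c.
  by have := hu0 0%N; rewrite expr0 mulr1; apply: le_trans; exact: hnorm_ge0.
have hu n : hnorm L2_form (u n.+1 - u n) <= c * q ^+ n.
  apply: le_trans (hu0 n) _; apply: ler_wpM2l => //; apply: lerXn2r.
  - by rewrite nnegrE.
  - by rewrite nnegrE ltW.
  - by rewrite le_max lexx.
have ex i j k : exists l, sqint mu l /\ exists K, forall n,
    \int[mu]_x ((l x - part k (val (u n) x i j)) ^+ 2) <= K * Num.sqrt (q ^+ 2) ^+ n.
  apply: (@sqint_complete _ _ _ mu _ (c ^+ 2)).
  - by rewrite exprn_gt0.
  - by rewrite exprn_ilt1 // ltW.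
  - by move=> n; exact: (L2P mu _).1 (L2_val (u n)) i j k.
  - move=> n; rewrite exprAC -exprMn.
    apply: le_trans (_ : hnorm L2_form (u n.+1 - u n) ^+ 2 <= _); last first.
      by rewrite ler_sqr ?nnegrE ?hnorm_ge0 // (le_trans _ (hu n)) ?hnorm_ge0.
    rewrite sqr_hnorm //; apply: le_trans (part_entry_le _ i j k).
    rewrite le_eqVlt; apply/orP; left; apply/eqP; apply: eq_Rintegral => x _.
    by rewrite /= !mxE partD partN.
have {ex} [l hl] : exists l : 'I_s -> 'I_r -> bool -> borel G -> R, forall i j k,
    sqint mu (l i j k) /\ exists K, forall n,
    \int[mu]_x ((l i j k x - part k (val (u n) x i j)) ^+ 2) <= K * q ^+ n.
  have ex' (p : 'I_s * 'I_r * bool) := ex p.1.1 p.1.2 p.2.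
  have [l hl] := choice ex'; exists (fun i j k => l (i, j, k)) => i j k.
  by have := hl (i, j, k); rewrite /= sqrtr_sqr ger0_norm // ltW.
have [K hK] := choice (fun p : 'I_s * 'I_r * bool => (hl p.1.1 p.1.2 p.2).2).
pose L (x : G) : Mx := \matrix_(i, j) Complex (l i j false x) (l i j true x).
have LL : L2 mu L.
  apply/L2P => i j k; have := (hl i j k).1.
  by congr sqint; apply/funext => x; rewrite mxE; case: k.
exists (mkL2 LL).
have bd n : hnorm L2_form (u n - mkL2 LL) <=
    Num.sqrt ((\sum_i \sum_j \sum_k K (i, j, k)) * q ^+ n).
  rewrite hnormB // /hnorm ler_wsqrtr // /L2_form Re_ip_self // !mulr_suml.
  apply: ler_sum => i _; rewrite mulr_suml; apply: ler_sum => j _.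
  rewrite mulr_suml; apply: ler_sum => k _.
  rewrite (le_trans _ (hK (i, j, k) n)) // le_eqVlt; apply/orP; left; apply/eqP.
  apply: eq_Rintegral => x _; congr (_ ^+ 2).
  by rewrite /= !mxE partD partN; case: k.
have cv : (fun n => Num.sqrt ((\sum_i \sum_j \sum_k K (i, j, k)) * q ^+ n)) @ \oo --> (0 : R).
  rewrite -[X in _ --> X]sqrtr0 -[X in Num.sqrt X](mulr0 (\sum_i \sum_j \sum_k K (i, j, k))).
  apply: continuous_cvg; first exact: sqrt_continuous.
  by apply: cvgMl_tmp; apply: cvg_expr; rewrite ger0_norm // ltW.
apply: (squeeze_cvgr _ (cvg_cst 0) cv); apply: nearW => n.
by rewrite hnorm_ge0 bd.
Qed.

(** An [op] acts on all functions; outside L2 the value 0 is a mere default. *)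
Definition to_op (F : L2_space -> L2_space) : op R G s r := fun f : G -> Mx =>
  if pselect (L2 mu f) is left Lf then val (F (mkL2 Lf)) else 0.

Lemma to_opE F f : to_op F (val f) = val (F f).
Proof.
rewrite /to_op; case: pselect => [Lf|]; last by move=> /(_ (L2_val f)).
by congr (val (F _)); exact: val_inj.
Qed.

Definition of_op (T : op R G s r) (TL : forall f : G -> Mx, L2 mu f -> L2 mu (T f)) f :=
  mkL2 (TL _ (L2_val f)).

End L2_space.

(** * Positive operators and matrix-valued Riesz bases *)

Section riesz_basis.
Variables (R : realType) (G : topologicalZmodType)
  (mu : {measure set (borel G) -> \bar R}) (s r : nat).
Local Notation Mx := 'M[R[i]]_(s, r).
Local Notation H := (L2_space mu s r).
Local Notation b := (@L2_form R G mu s r).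
Implicit Types f g h : H.
Let bP : psd_form b := L2_formP mu s r.
Local Hint Resolve L2_val : core.

(** Through the matrix adjoint V, <T (A f), g> = <A f, V g> = A <f, V g> = A <T f, g>. *)
Lemma of_op_mact (T : op R G s r) (TL : forall f : G -> Mx, L2 mu f -> L2 mu (T f)) A f g :
  mx_adjointable mu T ->
  b (of_op TL (mact A f)) g = b (mact A (of_op TL f)) g.
Proof.
move=> [V [VL TV]].
by rewrite L2_form_mactE /L2_form /ip !TV // mip_mulmx //; exact: VL.
Qed.

Lemma mact_adjoint A f g : b (mact A f) g = b f (mact (mxconj A) g).
Proof. exact: L2_form_mact. Qed.

(** Commuting with left multiplications upgrades selfadjointness from the scalar form to the
    matrix-valued product. *)
Lemma sa_mip (S : H -> H) : (forall f g, b (S f) g = b f (S g)) ->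
  (forall A f g, b (S (mact A f)) g = b (mact A (S f)) g) ->
  forall f g, mip mu (val (S f)) (val g) = mip mu (val f) (val (S g)).
Proof. by move=> Ssa SA f g; apply: mip_ext => A; rewrite -SA Ssa. Qed.

Lemma to_op_mip (S : H -> H) : (forall f g, b (S f) g = b f (S g)) ->
  (forall A f g, b (S (mact A f)) g = b (mact A (S f)) g) ->
  forall f g : G -> Mx, L2 mu f -> L2 mu g ->
    mip mu (to_op S f) g = mip mu f (to_op S g).
Proof.
move=> Ssa SA f g /L2_lift[F ->] /L2_lift[K ->].
by rewrite !to_opE; exact: sa_mip.
Qed.

Lemma to_op_L2 (S : H -> H) (f : G -> Mx) : L2 mu f -> L2 mu (to_op S f).
Proof. by move=> /L2_lift[F ->]; rewrite to_opE. Qed.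

(** Selfadjointness gives additivity almost everywhere, complex scalars act as scalar matrices, and
    boundedness is Hellinger-Toeplitz. *)
Lemma to_op_bounded_linear (S : H -> H) : (forall f g, b (S f) g = b f (S g)) ->
  (forall A f g, b (S (mact A f)) g = b (mact A (S f)) g) ->
  bounded_linear mu (to_op S).
Proof.
move=> Ssa SA; split.
- exact: to_op_L2.
- move=> f g /L2_lift[F ->] /L2_lift[K ->] /aeeqP FK.
  by rewrite !to_opE; apply/aeeqP => h; rewrite !Ssa.
- move=> a f g /L2_lift[F ->] /L2_lift[K ->].
  rewrite -[fun x => _]/(val (a *: F + K)) !to_opE.
  apply/(aeeqP _ (a *: S F + S K)) => h.
  by rewrite Ssa !(formDl bP) -!Ssa !scale_mact SA.
- have [c _ hc] := hellinger_toeplitz bP (@L2_form_complete R G mu s r) Ssa.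
  by exists c => f /L2_lift[F ->]; rewrite to_opE; exact: hc.
Qed.

Lemma positive_maps_riesz_basis (T : op R G s r) (E : nat -> G -> 'M[R[i]]_(s, r)) :
  bounded_linear mu T -> bijective_op mu T -> mx_adjointable mu T ->
  mx_onb mu E -> positive_op mu T ->
  exists U : op R G s r,
    [/\ bounded_linear mu U, bijective_op mu U, mx_adjointable mu U &
        exists Uinv W : op R G s r,
          [/\ inverse_op mu U Uinv, hilbert_adjoint mu Uinv W &
              forall k : nat, aeeq mu (T (U (E k))) (W (E k))]].
Proof.
move=> [TL _ _ _] [_ Tsurj] Tadj [EL _ _] [[_ Tsa] Tpos].
pose TH := of_op TL.
have Tsa' f g : b (TH f) g = b f (TH g) by rewrite /L2_form Tsa.
have T0 f : 0 <= b (TH f) f.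
  have := Tpos _ (L2_val f); rewrite /L2_form /=.
  by case: (ip mu _ _) => x y /=; rewrite lecE /= => /andP[].
have exQ f : exists g, forall h, b (TH g) h = b f h.
  have [g [/L2_lift[K ->] TK]] := Tsurj _ (L2_val f).
  by exists K; apply/(aeeqP (TH K)).
have [Q TQ] := choice exQ.
have [S [U [[Ssa Usa] SU US TU comm]]] := positive_inverse_square_root bP
  (@L2_form_complete R G mu s r) Tsa' T0 TQ.
have commA A : (forall f g, b (S (mact A f)) g = b (mact A (S f)) g) /\
               (forall f g, b (U (mact A f)) g = b (mact A (U f)) g).
  have [|SA UA] := comm _ _ (mact_adjoint A).
    by move=> f g; rewrite -mact_adjoint; exact: of_op_mact.
  by split=> f g; rewrite mact_adjoint.
have SA A := (commA A).1; have UA A := (commA A).2.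
exists (to_op U); split.
- exact: to_op_bounded_linear.
- split=> [f g /L2_lift[F ->] /L2_lift[K ->]|g /L2_lift[K ->]].
    rewrite !to_opE => /aeeqP UFK; apply/aeeqP => h.
    by rewrite -SU Ssa UFK -Ssa SU.
  by exists (val (S K)); split => //; rewrite to_opE; apply/aeeqP => h; exact: US.
- by exists (to_op U); split; [exact: to_op_L2|exact: to_op_mip].
(* [S] is the inverse of [U] and is its own adjoint, so it serves as both witnesses. *)
exists (to_op S), (to_op S); split.
- split=> [|f /L2_lift[F ->]]; first exact: to_op_L2.
  by rewrite !to_opE; split; apply/aeeqP => h.
- split=> [|f g Lf Lg]; first exact: to_op_L2.
  by rewrite /ip (to_op_mip Ssa SA).
- move=> k; have [F ->] := L2_lift (EL k); rewrite !to_opE.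
  by apply/(aeeqP (TH (U F))) => h; exact: TU.
Qed.

Lemma riesz_basis_positive (T U Uinv W : op R G s r) (E : nat -> G -> 'M[R[i]]_(s, r)) :
  bounded_linear mu T -> mx_adjointable mu T -> mx_onb mu E ->
  bounded_linear mu U -> bijective_op mu U -> mx_adjointable mu U ->
  inverse_op mu U Uinv -> hilbert_adjoint mu Uinv W ->
  (forall k : nat, aeeq mu (T (U (E k))) (W (E k))) ->
  positive_op mu T.
Proof.
move=> [TL Tae Tlin [cT0 Tbd0]] Tadj [EL _ Espan] [UL Uae Ulin [cU0 Ubd0]] [Uinj _] Uadj
  [IL UI] [WL IW] TUW.
pose TH := of_op TL; pose UH := of_op UL; pose IH := of_op IL; pose WH := of_op WL.
pose EH k := mkL2 (EL k).
have TA A f g : b (TH (mact A f)) g = b (mact A (TH f)) g by exact: of_op_mact.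
have UA A f g : b (UH (mact A f)) g = b (mact A (UH f)) g by exact: of_op_mact.
have Tcong f g h : (forall k, b f k = b g k) -> b (TH f) h = b (TH g) h.
  move=> /aeeqP fg; move: h; apply/(aeeqP (TH f)); exact: Tae.
have Ucong f g h : (forall k, b f k = b g k) -> b (UH f) h = b (UH g) h.
  move=> /aeeqP fg; move: h; apply/(aeeqP (UH f)); exact: Uae.
have UIH f h : b (UH (IH f)) h = b f h.
  by move: h; apply/(aeeqP (UH (IH f))); exact: (UI _ (L2_val f)).1.
(* The inverse of [U] commutes with left multiplication since [U] does and is injective. *)
have IA A f g : b (IH (mact A f)) g = b (mact A (IH f)) g.
  move: g; apply/(aeeqP (IH (mact A f))); apply: Uinj => //.
  apply/(aeeqP (UH (IH (mact A f))) (UH (mact A (IH f)))) => k.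
  by rewrite UIH UA !mact_adjoint UIH.
have TD f g h : b (TH (f + g)) h = b (TH f) h + b (TH g) h.
  have /(aeeqP (TH (1 *: f + g)) (1 *: TH f + TH g)) := Tlin 1 _ _ (L2_val f) (L2_val g).
  by rewrite !scale1r => ->; rewrite formDl.
have UD f g h : b (UH (f + g)) h = b (UH f + UH g) h.
  have /(aeeqP (UH (1 *: f + g)) (1 *: UH f + UH g)) := Ulin 1 _ _ (L2_val f) (L2_val g).
  by rewrite !scale1r => ->.
have TUD f g h : b (TH (UH (f + g))) h = b (TH (UH f)) h + b (TH (UH g)) h.
  by rewrite -TD; apply: Tcong.
(* The hypothesis on [E k] extends to its matrix multiples; the adjoint [W] is traded for [IH] on
   the other side. *)
have DE A k h : b (TH (UH (mact A (EH k)))) h = b (mact A (EH k)) (IH h).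
  have TUWk : forall h, b (TH (UH (EH k))) h = b (WH (EH k)) h.
    by apply/(aeeqP (TH (UH (EH k)))); exact: TUW.
  rewrite (Tcong _ _ _ (UA A (EH k))) TA !mact_adjoint TUWk formC //.
  by rewrite -[b _ (WH _)]/(complex.Re (ip mu _ (W _))) -IW // -[LHS]/(b (IH _) _) IA formC.
have DS n (M : nat -> 'M[R[i]]_s) h :
    b (TH (UH (\sum_(k < n) mact (M k) (EH k)))) h =
    b (\sum_(k < n) mact (M k) (EH k)) (IH h).
  elim: n => [|n IHn]; last by rewrite big_ord_recr /= TUD IHn DE -formDl.
  rewrite big_ord0; have <- : mact 0 (EH 0%N) = 0; last exact: DE.
  by apply: val_inj; apply/funext => x /=; rewrite mul0mx.
have TUbd f : hnorm b (TH (UH f)) <= `|cT0| * `|cU0| * hnorm b f.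
  apply: le_trans (Tbd0 _ (L2_val (UH f))) _.
  apply: le_trans (ler_wpM2r (hnorm_ge0 b (UH f)) (ler_norm cT0)) _.
  rewrite -mulrA ler_wpM2l //; apply: le_trans (Ubd0 _ (L2_val f)) _.
  by rewrite -[fnorm _ _]/(hnorm b f) ler_wpM2r ?hnorm_ge0 ?ler_norm.
(* Both sides agree on the partial sums [P n] of the expansion of [g] and are bounded in [g] for
   fixed [h], so their difference is at most a constant times the norm of [g - P n], which tends to
   0. *)
have D g h : b (TH (UH g)) h = b g (IH h).
  pose P n := \sum_(k < n) mact (mip mu (val g) (E k)) (EH k).
  have Pval n x : val (P n) x = \sum_(k < n) mip mu (val g) (E k) *m E k x.
    by rewrite /P; elim: n => [|n IHn]; rewrite ?big_ord0 // !big_ord_recr /= -IHn.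
  have cv : (fun n => hnorm b (g - P n)) @ \oo --> (0 : R).
    have e n : hnorm b (g - P n) = fnorm mu
        (fun x => val g x - \sum_(k < n) (mip mu (val g) (E k) *m E k x)).
      rewrite [X in fnorm mu X](_ : _ = val (g - P n)) //.
      by apply/funext => x; rewrite -Pval.
    by rewrite (funext e); exact: Espan.
  pose K := `|cT0| * `|cU0| * hnorm b h + hnorm b (IH h).
  have bd n : `|b (TH (UH g)) h - b g (IH h)| <= K * hnorm b (g - P n).
    have -> : b (TH (UH g)) h = b (TH (UH (g - P n))) h + b (P n) (IH h).
      by rewrite -(DS n (fun k => mip mu (val g) (E k))) -/(P n) -TUD subrK.
    have -> : b g (IH h) = b (g - P n) (IH h) + b (P n) (IH h).
      by rewrite -formDl // subrK.
    rewrite opprD addrACA subrr addr0.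
    apply: le_trans (ler_normB _ _) _; rewrite mulrDl lerD //.
      apply: le_trans (form_le bP _ _) _.
      by rewrite [leRHS]mulrAC ler_wpM2r ?hnorm_ge0 ?TUbd.
    by rewrite mulrC; exact: (form_le bP).
  have cvK : (fun n => K * hnorm b (g - P n)) @ \oo --> K * 0 by exact: cvgMl_tmp.
  apply/eqP; rewrite -subr_eq0 -normr_le0 -[leRHS](mulr0 K) -(cvg_lim _ cvK) //.
  apply: limr_ge; first by apply/cvg_ex; exists (K * 0).
  by apply: nearW => n; exact: bd.
(* Taking the inverse image of [f] under [U] for [g] exhibits T as J^* J, with J the inverse of
   U. *)
have Tform f h : b (TH f) h = b (IH f) (IH h).
  by rewrite -D; apply: Tcong => k; rewrite UIH.
have Tsa f g : b (TH f) g = b f (TH g) by rewrite Tform [RHS]formC // Tform formC.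
have Tmip f g : mip mu (T (val f)) (val g) = mip mu (val f) (T (val g)) := sa_mip Tsa TA f g.
split; first split => // f g /L2_lift[F ->] /L2_lift[K ->].
  by rewrite /ip Tmip.
move=> f /L2_lift[F ->].
have : complex.Re (ip mu (T (val F)) (val F)) = b (IH F) (IH F) by exact: Tform.
(* Nonnegativity in [R[i]] includes having zero imaginary part, which follows from the product being
   its own conjugate. *)
have : ip mu (T (val F)) (val F) = (ip mu (T (val F)) (val F))^*.
  by rewrite {1}/ip Tmip -/(ip mu _ _) (ip_conj (TL _ (L2_val F)) (L2_val F)).
case: (ip mu _ _) => x y /= -[yy] ->.
by rewrite lecE /= form_ge0 // andbT; apply/eqP; lra.
Qed.

End riesz_basis.

Theorem theorem3p19 (R : realType) (G : topologicalZmodType)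
  (hG : LCA_group G) (hmet : metrizable R G) (hsc : sigma_compact G)
  (mu : {measure set (borel G) -> \bar R}) (hmu : haar_measure mu)
  (s r : nat)
  (hONB : exists E : nat -> G -> 'M[R[i]]_(s, r), mx_onb mu E)
  (T : op R G s r)
  (hTbl : bounded_linear mu T) (hTbij : bijective_op mu T)
  (hTadj : mx_adjointable mu T) :
  positive_op mu T <->
  exists (E : nat -> G -> 'M[R[i]]_(s, r)) (U : op R G s r),
    [/\ mx_onb mu E, bounded_linear mu U, bijective_op mu U,
        mx_adjointable mu U &
        exists Uinv W : op R G s r,
          [/\ inverse_op mu U Uinv, hilbert_adjoint mu Uinv W &
              forall k : nat, aeeq mu (T (U (E k))) (W (E k))]].
Proof.
split=> [Tpos|[E [U [EO Ubl Ubij Uadj [Uinv [W [UI IW TUW]]]]]]].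
  (* In this direction any orthonormal basis will do. *)
  have [E EO] := hONB; exists E.
  have [U [Ubl Ubij Uadj UW]] := positive_maps_riesz_basis hTbl hTbij hTadj EO Tpos.
  by exists U.
exact: riesz_basis_positive hTbl hTadj EO Ubl Ubij Uadj UI IW TUW.
Qed.
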